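(* Let $N,M\ge 1$ be integers, let $\bm{A}_{\mathrm{intra}}\in\mathbb{R}^{N\times N}$ and $\bm{A}_{\mathrm{inter}}\in\mathbb{R}^{M\times M}$ have zero diagonal, and let $\omega_{\mathrm{intra}},\omega_{\mathrm{inter}}\in\mathbb{R}$. Let $\bm{\psi}^*\in\mathbb{R}^N$ be an equilibrium point of the intra-layer system $$\frac{d\psi_i}{dt}=\omega_{\mathrm{intra}}+\sum_{j=1}^{N}(\bm{A}_{\mathrm{intra}})_{ij}\sin(\psi_j-\psi_i),\qquad 1\le i\le N,$$ let $\bm{\phi}^*\in\mathbb{R}^M$ be an equilibrium point of the inter-layer system $$\frac{d\phi_l}{dt}=\omega_{\mathrm{inter}}+\sum_{k=1}^{M}(\bm{A}_{\mathrm{inter}})_{lk}\sin(\phi_k-\phi_l),\qquad 1\le l\le M,$$ and let $\bm{\theta}^*\in\mathbb{R}^{NM}$, $\theta^*_{N(l-1)+i}=\psi_i^*+\phi_l^*$ ($1\le l\le M$, $1\le i\le N$), be the composed equilibrium point of the multiplex system $$\frac{d\theta_i}{dt}=(\omega_{\mathrm{inter}}+\omega_{\mathrm{intra}})+\sum_{j=1}^{NM}\bm{K}_{ij}\sin(\theta_j-\theta_i),\qquad \bm{K}=\bm{A}_{\mathrm{intra}}\bigoplus\bm{A}_{\mathrm{inter}}.$$ Then the spectrum of the Jacobian of the multiplex system at $\bm{\theta}^*$ is determined by the spectra of the Jacobians of the intra-layer system at $\bm{\psi}^*$ and of the inter-layer system at $\bm{\phi}^*$, namely $$\operatorname{Spec}\big(\bm{J}_{\bm{K}}(\bm{\theta}^*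 )\big)=\operatorname{Spec}\big(\bm{J}_{\bm{A}_{\mathrm{intra}}}(\bm{\psi}^* )\big)+\operatorname{Spec}\big(\bm{J}_{\bm{A}_{\mathrm{inter}}}(\bm{\phi}^* )\big).$$
   Context: $\bm{J}_{\bm{A}_{\mathrm{intra}}}(\bm{\psi}^* )$, $\bm{J}_{\bm{A}_{\mathrm{inter}}}(\bm{\phi}^* )$, $\bm{J}_{\bm{K}}(\bm{\theta}^* )$ denote the Jacobian matrices of the right-hand sides of the intra-layer, inter-layer and multiplex systems at the indicated points. Explicitly, for $\bm{B}\in\mathbb{R}^{n\times n}$ with zero diagonal and $\bm{x}\in\mathbb{R}^n$: $(\bm{J}_{\bm{B}}(\bm{x}))_{ij}=\bm{B}_{ij}\cos(x_j-x_i)$ for $i\ne j$, and $(\bm{J}_{\bm{B}}(\bm{x}))_{ii}=-\sum_{j\ne i}\bm{B}_{ij}\cos(x_j-x_i)$. $\operatorname{Spec}$ is the multiset of (complex) eigenvalues counted with algebraic multiplicity. For $\operatorname{Spec}(\bm{X})=\{\alpha_i\}_{i=1}^{N}$ and $\operatorname{Spec}(\bm{Y})=\{\beta_j\}_{j=1}^{M}$, $\operatorname{Spec}(\bm{X})+\operatorname{Spec}(\bm{Y})$ is the multiset $\{\alpha_i+\beta_j\}_{1\le i\le N,\,1\le j\le M}$. Kronecker product convention: for $\bm{A}\in\mathbb{R}^{p\times q}$ and $\bm{B}=[b_{ij}]\in\mathbb{R}^{r\times s}$, $\bm{A}\otimes\bm{B}$ is the block matrix whose $(i,j)$ block is $\bm{A}b_{ij}$.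 For $\bm{A}\in\mathbb{R}^{r\times r}$, $\bm{B}\in\mathbb{R}^{s\times s}$, the Kronecker sum is $\bm{A}\bigoplus\bm{B}=\bm{A}\otimes\bm{I}_s+\bm{I}_r\otimes\bm{B}$, with $\bm{I}_k$ the $k\times k$ identity. Hence $\bm{K}$ has $M\times M$ blocks of size $N\times N$, with diagonal blocks $\bm{A}_{\mathrm{intra}}$ and $(l,k)$ block $(\bm{A}_{\mathrm{inter}})_{lk}\bm{I}_N$ for $l\ne k$. *)

(* Defs.v *)
From mathcomp Require Import all_boot all_order all_algebra.
From mathcomp Require Import all_classical all_reals all_analysis.
From mathcomp Require Import finmap multiset mxtens complex.

Set Implicit Arguments.
Unset Strict Implicit.
Unset Printing Implicit Defensive.

Import Order.TTheory GRing.Theory Num.Theory.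
Import numFieldNormedType.Exports.

Local Open Scope ring_scope.

Definition kuramoto (R : realType) (n : nat) (omega : R) (B : 'M[R]_n)
    (x : 'rV[R]_n) : 'rV[R]_n :=
  \row_i (omega + \sum_(j < n) B i j * sin (x 0 j - x 0 i)).

(* Equilibrium points of the autonomous system dx/dt = f x. *)
Definition equilibrium (R : realType) (n : nat) (f : 'rV[R]_n -> 'rV[R]_n)
    (x : 'rV[R]_n) : Prop := f x = 0.

(* The library's jacobian acts on row vectors, v |-> v *m 'J f x, so the usual
   Jacobian matrix, with (i, j) entry the partial derivative of the i-th
   component of f along the j-th coordinate, is its transpose; see
   Jacobian_kuramotoE for the entries in the case of interest. *)
Definition Jacobian (R : realType) (n : nat) (f : 'rV[R]_n -> 'rV[R]_n)
    (x : 'rV[R]_n) : 'M[R]_n := ('J f x)^T.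

(* A (x) B is the block matrix with (i, j) block b_ij A, which is the library's
   B *t A, since the (i, j) block of the latter is b_ij A. The index of the
   entry i of block l is mxtens_index (l, i), with value l * n + i. *)
Definition kron (R : pzRingType) (p q r s : nat) (A : 'M[R]_(p, q))
    (B : 'M[R]_(r, s)) : 'M[R]_(r * p, s * q) := B *t A.

Definition kron_sum (R : pzRingType) (r s : nat) (A : 'M[R]_r) (B : 'M[R]_s) :
    'M[R]_(s * r) := kron A (1%:M : 'M[R]_s) + kron (1%:M : 'M[R]_r) B.

Definition composed (R : realType) (N M : nat) (psi : 'rV[R]_N)
    (phi : 'rV[R]_M) : 'rV[R]_(M * N) :=
  \row_k (psi 0 (mxtens_unindex k).2 + phi 0 (mxtens_unindex k).1).

(* The multiset of the complex roots of the characteristic polynomial, each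
   with its multiplicity; see SpecE. *)
Definition Spec (R : realType) (n : nat) (A : 'M[R]_n) : {mset R[i]}%mset :=
  seq_mset (sval (closed_field_poly_normal
    (char_poly (map_mx (real_complex R) A)))).

Definition mset_sum (V : nmodType) (S T : {mset V}%mset) : {mset V}%mset :=
  seq_mset [seq a + b | a <- S, b <- T].

Lemma SpecE (R : realType) (n : nat) (A : 'M[R]_n) (z : R[i]) :
  Spec A z = mup z (char_poly (map_mx (real_complex R) A)).
Proof.
rewrite /Spec mset_seqE; case: closed_field_poly_normal => s /= ->.
by rewrite (monicP (char_poly_monic _)) scale1r mu_prod_XsubC.
Qed.

Lemma composedE (R : realType) (N M : nat) (psi : 'rV[R]_N) (phi : 'rV[R]_M)
    (i : 'I_N) (l : 'I_M) :
  composed psi phi 0 (mxtens_index (l, i)) = psi 0 i + phi 0 l.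
Proof. by rewrite mxE mxtens_indexK. Qed.

Lemma kron_sumE (R : pzRingType) (N M : nat) (A : 'M[R]_N) (B : 'M[R]_M)
    (i j : 'I_N) (l k : 'I_M) :
  kron_sum A B (mxtens_index (l, i)) (mxtens_index (k, j)) =
  (l == k)%:R * A i j + B l k * (i == j)%:R.
Proof. by rewrite mxE !tensmxE !mxE. Qed.

Section KuramotoDerivative.
Context (R : realType) (n : nat).
Implicit Types (x : 'rV[R]_n) (B : 'M[R]_n).

Let coord_diff k x : is_diff x (fun y : 'rV[R]_n => y 0 k) (fun v => v 0 k).
Proof.
have @f : {linear 'rV[R]_n -> R}.
  by exists (fun y : 'rV[R]_n => y 0 k); do 2![eexists]; do ?[constructor];
     rewrite ?mxE// => ? *; rewrite ?mxE//; move=> ?; rewrite !mxE.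
apply: DiffDef; first exact: differentiable_coord.
by rewrite (_ : (fun y : 'rV[R]_n => y 0 k) = f) // diff_lin //;
  exact: coord_continuous.
Qed.

Let sin_diff (t : R) : is_diff t (@sin R) (fun h => cos t * h).
Proof.
have dsin : differentiable (@sin R) t.
  by apply/derivable1_diffP; exact: ex_derive.
apply: DiffDef => //; apply/funext => h.
rewrite -[h in LHS]mulr1 -[h * 1]/(h *: (1 : R)) linearZ /=.
by rewrite -deriveE // derive_val mulrC.
Qed.

Let term_diff (b : R) (i j : 'I_n) x :
  is_diff x (fun y : 'rV[R]_n => b * sin (y 0 j - y 0 i))
    (fun v => b * (cos (x 0 j - x 0 i) * (v 0 j - v 0 i))).
Proof.
have h1 := is_diffB (coord_diff j x) (coord_diff i x).
have h2 := is_diff_comp h1 (sin_diff (x 0 j - x 0 i)).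
exact: (is_diffZ b h2).
Qed.

Let kuramoto_diff (omega : R) B x :
  is_diff x (kuramoto omega B) (fun v => \row_i
    \sum_(j < n) B i j * (cos (x 0 j - x 0 i) * (v 0 j - v 0 i))).
Proof.
pose g i j (y : 'rV[R]_n) : 'rV[R]_n :=
  (B i j * sin (y 0 j - y 0 i)) *: delta_mx 0 i.
pose dg i j (v : 'rV[R]_n) : 'rV[R]_n :=
  (B i j * (cos (x 0 j - x 0 i) * (v 0 j - v 0 i))) *: delta_mx 0 i.
have gd i j : is_diff x (g i j) (dg i j).
  exact: (is_diff_comp (term_diff (B i j) i j x)
            (is_diff_scalel _ (delta_mx 0 i : 'rV[R]_n))).
have sumd (I : Type) (r : seq I) (F dF : I -> 'rV[R]_n -> 'rV[R]_n) :
    (forall i, is_diff x (F i) (dF i)) ->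
    is_diff x (\sum_(i <- r) F i) (\sum_(i <- r) dF i).
  move=> Fd; elim: r => [|a r IH]; first by rewrite !big_nil; exact: is_diff_cst.
  by rewrite !big_cons; exact: is_diffD.
have sumE (F : 'I_n -> 'I_n -> 'rV[R]_n -> R) y :
    (\sum_i \sum_j (fun z => F i j z *: (delta_mx 0 i : 'rV[R]_n))) y =
    \row_i \sum_j F i j y.
  rewrite fct_sumE [RHS]row_sum_delta; apply: eq_bigr => i _.
  by rewrite fct_sumE mxE scaler_suml.
have := is_diffD (is_diff_cst (\row__ omega : 'rV[R]_n) x)
  (sumd _ (index_enum _) _ _ (fun i => sumd _ (index_enum _) _ _ (gd i))).
have -> : cst (\row__ omega) + \sum_i \sum_j g i j = kuramoto omega B.
  apply/funext => y; rewrite -[LHS]/(\row__ omega + (\sum_i \sum_j g i j) y).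
  by rewrite sumE; apply/rowP => i; rewrite !mxE.
have -> // : 0 + \sum_i \sum_j dg i j = (fun v => \row_i
    \sum_(j < n) B i j * (cos (x 0 j - x 0 i) * (v 0 j - v 0 i))).
by rewrite add0r; apply/funext => v; rewrite sumE.
Qed.

Lemma Jacobian_kuramotoE (omega : R) B x (i j : 'I_n) :
  Jacobian (kuramoto omega B) x i j =
  if i == j then - \sum_(k < n | k != i) B i k * cos (x 0 k - x 0 i)
  else B i j * cos (x 0 j - x 0 i).
Proof.
rewrite !mxE /= (diff_val (is_diff_def := kuramoto_diff omega B x)) mxE.
have [<-|ij] := eqVneq i j.
  rewrite (bigD1 i) //= !subrr !mulr0 add0r -sumrN; apply: eq_bigr => k ki.
  by rewrite !mxE !eqxx (negPf ki) /= sub0r mulrN1 mulrN.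
rewrite (bigD1 j) //= !mxE !eqxx (negPf ij) /= subr0 mulr1.
rewrite big1 ?addr0 // => k kj.
by rewrite !mxE (negPf kj) andbF subrr !mulr0.
Qed.

End KuramotoDerivative.

Lemma composed_equilibrium (R : realType) (N M : nat) (A : 'M[R]_N)
    (B : 'M[R]_M) (w v : R) (psi : 'rV[R]_N) (phi : 'rV[R]_M) :
  equilibrium (kuramoto w A) psi -> equilibrium (kuramoto v B) phi ->
  equilibrium (kuramoto (v + w) (kron_sum A B)) (composed psi phi).
Proof.
move=> /rowP hA /rowP hB; apply/rowP => p; case: (mxtens_indexP p) => l i.
have eA : w + \sum_(j < N) A i j * sin (psi 0 j - psi 0 i) = 0.
  by have := hA i; rewrite !mxE.
have eB : v + \sum_(k < M) B l k * sin (phi 0 k - phi 0 l) = 0.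
  by have := hB l; rewrite !mxE.
rewrite [LHS]mxE [RHS]mxE.
rewrite (reindex (@mxtens_index M N)) /=; last first.
  by exists (@mxtens_unindex M N) => q _; [exact: mxtens_indexK|exact: mxtens_unindexK].
transitivity ((v + \sum_(k < M) B l k * sin (phi 0 k - phi 0 l)) +
  (w + \sum_(j < N) A i j * sin (psi 0 j - psi 0 i))); last by rewrite eA eB addr0.
rewrite addrACA; congr (_ + _).
transitivity (\sum_(q : 'I_M * 'I_N)
  ((l == q.1)%:R * A i q.2 + B l q.1 * (i == q.2)%:R) *
  sin (psi 0 q.2 + phi 0 q.1 - (psi 0 i + phi 0 l))).
  by apply: eq_bigr => -[k j] _; rewrite kron_sumE !composedE.
rewrite -(pair_bigA _ (fun k j => ((l == k)%:R * A i j + B l k * (i == j)%:R) *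
  sin (psi 0 j + phi 0 k - (psi 0 i + phi 0 l)))) /=.
under eq_bigr do under eq_bigr do rewrite mulrDl.
under eq_bigr do rewrite big_split.
rewrite big_split /= addrC; congr (_ + _).
  apply: eq_bigr => k _; rewrite (bigD1 i) //= eqxx mulr1 big1 ?addr0.
    by congr (_ * sin _); rewrite opprD addrACA subrr add0r.
  by move=> j ji; rewrite eq_sym (negPf ji) mulr0 mul0r.
rewrite (bigD1 l) //= [X in _ + X]big1 ?addr0; last first.
  by move=> k kl; rewrite big1 // => j _; rewrite eq_sym (negPf kl) !mul0r.
apply: eq_bigr => j _; rewrite eqxx mul1r.
by congr (_ * sin _); rewrite opprD addrACA subrr addr0.
Qed.

(* Main.v *)
Require Import Defs.
From mathcomp Require Import all_boot all_order all_algebra.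
From mathcomp Require Import all_classical all_reals all_analysis.
From mathcomp Require Import finmap multiset mxtens complex.
From mathcomp Require Import ring.

Set Implicit Arguments.
Unset Strict Implicit.
Unset Printing Implicit Defensive.

Import Order.TTheory GRing.Theory Num.Theory.
Import numFieldNormedType.Exports.

Local Open Scope ring_scope.

(** The entry of the multiplex Jacobian between node i of layer l and node j of
layer k vanishes unless k = l or j = i.  For k = l the two components of the
composed point share the phase phi_l, so their difference is psi_j - psi_i; for
j = i they share psi_i, so it is phi_k - phi_l.  Hence each nonzero off-diagonal
entry of the multiplex Jacobian is an entry of one of the two small Jacobians,
while a diagonal one is minus a sum over both kinds of neighbours: the Jacobian
of the composed system is the Kronecker sum of the two Jacobians
([Jacobian_composed]).

The spectrum of a Kronecker sum is a fact of linear algebra ([Spec_kron_sum]).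
Over the complex numbers both factors are conjugate to lower triangular
matrices by the Schur decomposition; the tensor product of the two base changes
conjugates the Kronecker sum to the Kronecker sum of the triangular matrices,
which is again triangular, with the sums of diagonal entries on its diagonal.
The characteristic polynomials of all three matrices can then be read off the
diagonals. *)

(** * Kronecker sums of trigonalizable matrices *)

Lemma char_poly_similar (F : fieldType) (n : nat) (P A B : 'M[F]_n) :
  P \in unitmx -> P *m A = B *m P -> char_poly A = char_poly B.
Proof.
move=> Pu PA; pose Q := map_mx polyC P.
have detQ : \det Q != 0.
  by rewrite det_map_mx polyC_eq0 -unitfE -unitmxE.
apply: (mulfI detQ); rewrite [RHS]mulrC /char_poly -!det_mulmx; congr (\det _).
by rewrite mulmxBr mulmxBl scalar_mxC -!map_mxM PA.
Qed.

(** The index (l, i) has value l * N + i, so indices are ordered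
lexicographically: a larger index has a larger layer, where both summands have
a vanishing factor, or the same layer and a larger i, where only the triangular
A contributes. *)
Lemma kron_sum_trig (R : pzRingType) (N M : nat) (A : 'M[R]_N) (B : 'M[R]_M) :
  is_trig_mx A -> is_trig_mx B -> is_trig_mx (kron_sum A B).
Proof.
move=> /is_trig_mxP trigA /is_trig_mxP trigB; apply/is_trig_mxP => p q.
case: (mxtens_indexP p) => l i; case: (mxtens_indexP q) => k j.
rewrite kron_sumE /= => lt_pq.
have [lk|kl|/val_inj lk] := ltngtP l k.
- by rewrite trigB // mul0r addr0 -val_eqE ltn_eqF ?mul0r.
- suff : (k * N + j < l * N + i)%N by rewrite ltnNge (ltnW lt_pq).
  apply: (@leq_trans (k.+1 * N)); first by rewrite mulSn addnC ltn_add2r.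
  by rewrite (leq_trans (leq_mul kl (leqnn N))) // leq_addr.
move: lt_pq; rewrite lk ltn_add2l => ij.
by rewrite trigA // mulr0 add0r -val_eqE ltn_eqF ?mulr0.
Qed.

Lemma kron_sum_similar (R : comPzRingType) (N M : nat) (P A A' : 'M[R]_N)
    (Q B B' : 'M[R]_M) :
  P *m A = A' *m P -> Q *m B = B' *m Q ->
  (Q *t P) *m kron_sum A B = kron_sum A' B' *m (Q *t P).
Proof.
move=> PA QB; rewrite /kron_sum /kron mulmxDr mulmxDl !tensmx_mul.
by rewrite PA QB !mulmx1 !mul1mx.
Qed.

Lemma big_mxtens_index (R : Type) (idx : R) (op : Monoid.com_law idx)
    (N M : nat) (F : 'I_(M * N) -> R) :
  \big[op/idx]_p F p =
  \big[op/idx]_(l < M) \big[op/idx]_(i < N) F (mxtens_index (l, i)).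
Proof.
rewrite (reindex (@mxtens_index M N)) /=; last first.
  by exists (@mxtens_unindex M N) => q _;
    [exact: mxtens_indexK | exact: mxtens_unindexK].
by rewrite (pair_bigA _ (fun l i => F (mxtens_index (l, i)))) /=;
  apply: eq_bigr => -[].
Qed.

Lemma char_poly_kron_sum (F : fieldType) (N M : nat) (A : 'M[F]_N)
    (B : 'M[F]_M) :
  (0 < N)%N -> (0 < M)%N -> trigonalizable A -> trigonalizable B ->
  exists s t : seq F,
    [/\ char_poly A = \prod_(a <- s) ('X - a%:P),
        char_poly B = \prod_(b <- t) ('X - b%:P) &
        char_poly (kron_sum A B) =
          \prod_(c <- [seq a + b | a <- s, b <- t]) ('X - c%:P)].
Proof.
move=> N_gt0 M_gt0 [P Pu trigA] [Q Qu trigB].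
set A' := conjmx P A in trigA; set B' := conjmx Q B in trigB.
have PA : P *m A = A' *m P by apply/(similarP Pu)/eqP.
have QB : Q *m B = B' *m Q by apply/(similarP Qu)/eqP.
exists [seq A' i i | i <- index_enum 'I_N], [seq B' l l | l <- index_enum 'I_M].
split.
- by rewrite (char_poly_similar Pu PA) char_poly_trig // big_map.
- by rewrite (char_poly_similar Qu QB) char_poly_trig // big_map.
rewrite (char_poly_similar _ (kron_sum_similar PA QB));
  last by rewrite tensmx_unit // -lt0n.
rewrite char_poly_trig ?kron_sum_trig // big_mxtens_index exchange_big /=.
rewrite big_allpairs_dep big_map; apply: eq_bigr => i _.
rewrite big_map; apply: eq_bigr => l _.
by rewrite kron_sumE !eqxx mul1r mulr1.
Qed.

(** * Spectra as multisets *)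

Lemma Spec_prod (R : realType) (n : nat) (A : 'M[R]_n) (s : seq R[i]) :
  char_poly (map_mx (real_complex R) A) = \prod_(a <- s) ('X - a%:P) ->
  Spec A = seq_mset s.
Proof.
by move=> As; apply/msetP => z; rewrite SpecE As mu_prod_XsubC mset_seqE.
Qed.

Lemma mset_sum_seq (V : nmodType) (s t : seq V) :
  mset_sum (seq_mset s) (seq_mset t) = seq_mset [seq a + b | a <- s, b <- t].
Proof.
by apply/eq_seq_msetP; apply: perm_allpairs; exact: perm_eq_seq_mset.
Qed.

Lemma Spec_kron_sum (R : realType) (N M : nat) (A : 'M[R]_N) (B : 'M[R]_M) :
  (0 < N)%N -> (0 < M)%N ->
  Spec (kron_sum A B) = mset_sum (Spec A) (Spec B).
Proof.
move=> N_gt0 M_gt0.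
have trigC n (C : 'M[R[i]]_n) : (0 < n)%N -> trigonalizable C.
  by move=> /(Schur C)[P /unitarymx_unit Pu trigC]; exists P.
have [s [t [As Bt ABst]]] := char_poly_kron_sum N_gt0 M_gt0
  (trigC _ (map_mx (real_complex R) A) N_gt0)
  (trigC _ (map_mx (real_complex R) B) M_gt0).
rewrite (Spec_prod As) (Spec_prod Bt) mset_sum_seq.
apply: Spec_prod; rewrite -ABst; congr char_poly.
by rewrite /kron_sum /kron map_mxD !map_mxT !map_mx1.
Qed.

(** * The Jacobian of the composed system *)

Definition cos_weights (R : realType) (n : nat) (B : 'M[R]_n) (x : 'rV[R]_n) :
    'M[R]_n :=
  \matrix_(i, j) (B i j * cos (x 0 j - x 0 i)).

(** The Jacobian is the weight matrix minus the diagonal matrix of its row sums.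
The diagonal weight occurs in both terms and cancels, so the formula needs no
case distinction and the row sums range over all indices. *)
Lemma Jacobian_cos_weights (R : realType) (n : nat) (w : R) (B : 'M[R]_n)
    (x : 'rV[R]_n) (i j : 'I_n) :
  Jacobian (kuramoto w B) x i j =
  cos_weights B x i j - (i == j)%:R * \sum_k cos_weights B x i k.
Proof.
rewrite Jacobian_kuramotoE; have [<-|_] := eqVneq i j; last first.
  by rewrite mul0r subr0 mxE.
rewrite mul1r [X in _ = _ - X](bigD1 i) //= opprD addrA subrr sub0r.
by congr (- _); apply: eq_bigr => k _; rewrite mxE.
Qed.

(** An intra-layer edge sees the phase difference of psi alone and an
inter-layer edge that of phi alone. *)
Lemma cos_weights_composed (R : realType) (N M : nat) (A : 'M[R]_N)
    (B : 'M[R]_M) (psi : 'rV[R]_N) (phi : 'rV[R]_M) :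
  cos_weights (kron_sum A B) (composed psi phi) =
  kron_sum (cos_weights A psi) (cos_weights B phi).
Proof.
apply/matrixP => p q.
case: (mxtens_indexP p) => l i; case: (mxtens_indexP q) => k j.
rewrite [LHS]mxE !kron_sumE !composedE [cos_weights A psi i j]mxE.
rewrite [cos_weights B phi l k]mxE mulrDl opprD addrACA; congr (_ + _).
  have [<-|_] := eqVneq l k; last by rewrite !mul0r.
  by rewrite !mul1r subrr addr0.
have [<-|_] := eqVneq i j; last by rewrite !mulr0 mul0r.
by rewrite !mulr1 subrr add0r.
Qed.

Lemma row_sum_kron_sum (R : pzRingType) (N M : nat) (A : 'M[R]_N) (B : 'M[R]_M)
    (l : 'I_M) (i : 'I_N) :
  \sum_q kron_sum A B (mxtens_index (l, i)) q =
  \sum_j A i j + \sum_k B l k.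
Proof.
rewrite big_mxtens_index.
under eq_bigr do under eq_bigr do rewrite kron_sumE.
under eq_bigr do rewrite big_split /= -mulr_sumr -mulr_sumr.
rewrite big_split /= -mulr_suml; congr (_ + _).
  by rewrite (bigD1 l) //= eqxx big1 ?addr0 ?mul1r // => k /negPf kl;
    rewrite eq_sym kl.
apply: eq_bigr => k _; rewrite (bigD1 i) //= eqxx big1 ?addr0 ?mulr1 //.
by move=> j /negPf ji; rewrite eq_sym ji.
Qed.

Lemma Jacobian_composed (R : realType) (N M : nat) (A : 'M[R]_N) (B : 'M[R]_M)
    (w u v : R) (psi : 'rV[R]_N) (phi : 'rV[R]_M) :
  Jacobian (kuramoto w (kron_sum A B)) (composed psi phi) =
  kron_sum (Jacobian (kuramoto u A) psi) (Jacobian (kuramoto v B) phi).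
Proof.
apply/matrixP => p q.
case: (mxtens_indexP p) => l i; case: (mxtens_indexP q) => k j.
rewrite kron_sumE !Jacobian_cos_weights cos_weights_composed row_sum_kron_sum.
rewrite kron_sumE (can_eq (@mxtens_indexK M N)) xpair_eqE -mulnb natrM; ring.
Qed.

Theorem propositionV1 (R : realType) (N M : nat) (hN : (1 <= N)%N)
    (hM : (1 <= M)%N) (A_intra : 'M[R]_N) (A_inter : 'M[R]_M)
    (hA_intra : forall i : 'I_N, A_intra i i = 0)
    (hA_inter : forall l : 'I_M, A_inter l l = 0)
    (omega_intra omega_inter : R) (psi : 'rV[R]_N) (phi : 'rV[R]_M)
    (hpsi : equilibrium (kuramoto omega_intra A_intra) psi)
    (hphi : equilibrium (kuramoto omega_inter A_inter) phi) :
  Spec (Jacobian (kuramoto (omega_inter + omega_intra)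
                           (kron_sum A_intra A_inter))
                 (composed psi phi)) =
  mset_sum (Spec (Jacobian (kuramoto omega_intra A_intra) psi))
           (Spec (Jacobian (kuramoto omega_inter A_inter) phi)).
Proof.
by rewrite (Jacobian_composed _ _ _ omega_intra omega_inter) Spec_kron_sum.
Qed.
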